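(* Let $p$ be a prime, let $w = w(x_1,\ldots,x_n)$ be a word, and let $G$ be a $w$-maximal finite $p$-group such that $w$ is interchangeable in $G$. Then $w(G) \leq Z(G)$, where $Z(G)$ denotes the centre of $G$.
   Context: For a word $w = w(x_1,\ldots,x_n)$ (an element of the free group on $x_1,\ldots,x_n$) and a group $G$, the verbal subgroup $w(G)$ is the subgroup of $G$ generated by all values $w(g_1,\ldots,g_n)^{\pm 1}$ with $g_i \in G$. A finite group $G$ is $w$-maximal if $|G:w(G)| > |H:w(H)|$ for all proper subgroups $H$ of $G$. The word $w$ is interchangeable in a finite $p$-group $G$ if for every normal subgroup $N$ of $G$, $$[w(N),G] \leq [N,w(G)] \cdot [w(G),G]^p \, [w(G),G,G].$$ Here $[A,B]$ is the subgroup generated by all commutators $[a,b]=a^{-1}b^{-1}ab$ with $a \in A$, $b\in B$; $[A,B,C] = [[A,B],C]$; and for a group $K$, $K^p$ is the subgroup generated by all $p$th powers of elements of $K$. *)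

(* Defs.v *)
From HB Require Import structures.
From mathcomp Require Import all_boot all_fingroup all_solvable.

Set Implicit Arguments.
Unset Strict Implicit.
Unset Printing Implicit Defensive.

Import GroupScope.

(* A word in x_0, ..., x_(n-1) is a list of letters; (i, false) stands for
   x_i and (i, true) for x_i^-1. Words need not be reduced: every element of
   the free group is represented by some list, and by word_eval_cancel lists
   representing the same element have the same value in every group. *)
Definition word (n : nat) := seq ('I_n * bool).

Definition letter_eval (gT : finGroupType) (n : nat) (g : 'I_n -> gT)
    (l : 'I_n * bool) : gT :=
  if l.2 then (g l.1)^-1 else g l.1.

Definition word_eval (gT : finGroupType) (n : nat) (w : word n)
    (g : 'I_n -> gT) : gT :=
  \prod_(l <- w) letter_eval g l.

Lemma word_eval_cancel (gT : finGroupType) (n : nat) (u v : word n)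
    (i : 'I_n) (b : bool) (g : 'I_n -> gT) :
  word_eval (u ++ (i, b) :: (i, ~~ b) :: v) g = word_eval (u ++ v) g.
Proof.
rewrite /word_eval !big_cat !big_cons /= /letter_eval /=; congr (_ * _).
by case: b; rewrite ?mulKg ?mulKVg.
Qed.

Definition word_values (gT : finGroupType) (n : nat) (w : word n)
    (A : {set gT}) : {set gT} :=
  [set word_eval w g | g : {ffun 'I_n -> gT} in ffun_on A].

Definition verbal (gT : finGroupType) (n : nat) (w : word n)
    (A : {set gT}) : {set gT} :=
  <<word_values w A :|: (word_values w A)^-1>>.

Canonical verbal_group (gT : finGroupType) (n : nat) (w : word n)
    (A : {set gT}) := [group of verbal w A].

Definition w_maximal (gT : finGroupType) (n : nat) (w : word n)
    (G : {group gT}) : Prop :=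
  forall H : {group gT}, H \proper G ->
    (#|H : verbal w H| < #|G : verbal w G|)%N.

(* Unlike 'Mho^1(K), this does not presuppose that K is a p-group. *)
Definition power_subgroup (gT : finGroupType) (k : nat) (K : {set gT}) :
    {set gT} :=
  <<[set x ^+ k | x in K]>>.

Canonical power_subgroup_group (gT : finGroupType) (k : nat) (K : {set gT}) :=
  [group of power_subgroup k K].

(* When N <| G the three factors are normal in G, so the set product below is
   a subgroup. *)
Definition interchangeable (gT : finGroupType) (p n : nat) (w : word n)
    (G : {group gT}) : Prop :=
  forall N : {group gT}, N <| G ->
    [~: verbal w N, G] \subset
      [~: N, verbal w G] * power_subgroup p [~: verbal w G, G]
        * [~: verbal w G, G, G].

(* Main.v *)
Require Import Defs.
From HB Require Import structures.
From mathcomp Require Import all_boot all_fingroup all_solvable.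

Set Implicit Arguments.
Unset Strict Implicit.
Unset Printing Implicit Defensive.

Import GroupScope.

(** Write W for the verbal subgroup of G and suppose that L = [W, G] is not
    trivial. As G is nilpotent, [L, G] is a proper subgroup of L, hence lies in
    a maximal subgroup N of L; then N is normal in G, and L / N has order p, so
    that N contains [L, G] together with all pth powers of elements of L.

    Modulo N the commutator map pairs G with W, with values in a group of order
    p. Let C be the centraliser of W modulo N in G, and Z the centraliser of G
    modulo N in W. Such a pairing satisfies |G : C| <= |W : Z|
    ([index_cent_le]). Interchangeability for the normal subgroup C says that
    [w(C), G] lies in [C, W] N = N, hence w(C) <= Z. Therefore
      |C : w(C)| >= |C| / |Z| >= |G| / |W| = |G : W|,
    and maximality of G forces C = G, i.e. [W, G] <= N, which is absurd because
    N is proper in L. *)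

Section Verbal.

Variables (gT : finGroupType) (n : nat) (w : word n).

Lemma word_eval_in (A : {group gT}) (g : 'I_n -> gT) :
  (forall i, g i \in A) -> word_eval w g \in A.
Proof.
move=> gA; apply: group_prod => -[i b] _.
by rewrite /letter_eval /=; case: b; rewrite ?groupV gA.
Qed.

Lemma word_eval_conj (g : 'I_n -> gT) (x : gT) :
  word_eval w g ^ x = word_eval w (fun i => g i ^ x).
Proof.
rewrite /word_eval; elim: w => [|[i b] v IHv]; first by rewrite !big_nil conj1g.
rewrite !big_cons conjMg IHv; congr (_ * _).
by rewrite /letter_eval /=; case: b; rewrite ?conjVg.
Qed.

Lemma verbal_sub (A : {group gT}) : verbal w A \subset A.
Proof.
have sVA : word_values w A \subset A.
  by apply/subsetP=> _ /imsetP[g /ffun_onP gA ->]; exact: word_eval_in.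
by rewrite gen_subG subUset sVA; move: sVA; rewrite -invSg invGid.
Qed.

Lemma verbalS (A B : {set gT}) : A \subset B -> verbal w A \subset verbal w B.
Proof.
move=> sAB; have sV : word_values w A \subset word_values w B.
  apply/subsetP=> _ /imsetP[g /ffun_onP gA ->].
  by apply: imset_f; apply/ffun_onP=> i; apply: (subsetP sAB).
by rewrite genS // setUSS ?invSg.
Qed.

Lemma verbal_norm (A : {group gT}) : A \subset 'N(verbal w A).
Proof.
have sJ x : x \in A -> word_values w A :^ x \subset word_values w A.
  move=> Ax; apply/subsetP=> _ /imsetP[_ /imsetP[g /ffun_onP gA ->] ->].
  apply/imsetP; exists [ffun i => g i ^ x].
    by apply/ffun_onP=> i; rewrite ffunE groupJ.
  rewrite word_eval_conj /word_eval; apply: eq_bigr => l _.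
  by rewrite /letter_eval ffunE.
apply/subsetP=> x Ax; rewrite inE -genJ genS // conjUg setUSS ?sJ //.
apply/subsetP=> y; rewrite mem_conjg !mem_invg -conjVg -mem_conjg.
exact: (subsetP (sJ x Ax)).
Qed.

End Verbal.

Lemma power_subgroup_sub_index (gT : finGroupType) (N L : {group gT}) :
  N <| L -> power_subgroup #|L : N| L \subset N.
Proof.
case/andP=> sNL nNL; rewrite gen_subG; apply/subsetP=> _ /imsetP[x Lx ->].
have nNx := subsetP nNL x Lx.
rewrite coset_idr ?groupX // morphX // -card_quotient //.
by apply/eqP; rewrite -order_dvdn order_dvdG ?mem_quotient.
Qed.

(** Half of the duality of the commutator pairing of A with G. Climb from
    'C_A(G) to A through successive maximal subgroups: each step multiplies the
    right-hand index by p, while passing from 'C_G(B) to 'C_G(B <*> <[x]>)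
    multiplies the left-hand one by at most the number of G-conjugates of x,
    all of which lie in the coset x [A, G]. *)
Lemma index_cent_le (gT : finGroupType) (p : nat) (A G : {group gT}) :
  p.-group A -> (#|[~: A, G]| <= p)%N ->
  (#|G : 'C_G(A)| <= #|A : 'C_A(G)|)%N.
Proof.
have [m] := ubnP #|A|; elim: m A => // m IHm A leAm pA leAGp.
have [eqA | [B maxB sCB]] := maximal_exists (subsetIl A 'C(G)).
  have cAG : A \subset 'C(G) by rewrite -eqA subsetIr.
  by rewrite (setIidPl _) 1?centsC // indexgg indexg_gt0.
have prBA := maxgroupp maxB; have [sBA [x Ax notBx]] := properP prBA.
have leBG : (#|[~: B, G]| <= p)%N.
  by apply: leq_trans leAGp; rewrite subset_leq_card ?commSg.
have ltBm : (#|B| < m)%N.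
  by apply: leq_trans (proper_card prBA) _; rewrite -ltnS.
have := IHm B ltBm (pgroupS sBA pA) leBG.
have -> : 'C_B(G) = 'C_A(G).
  by apply/eqP; rewrite eqEsubset setSI //= subsetI sCB subsetIr.
move=> leIB.
have cardxG : (#|x ^: G| <= p)%N.
  apply: leq_trans leAGp; rewrite -(card_lcoset [~: A, G] x) subset_leq_card //.
  apply/subsetP=> _ /imsetP[g Gg ->].
  by rewrite mem_lcoset -/(commg x g) mem_commg.
have defA : 'C_G(B) :&: 'C_G[x] = 'C_G(A).
  have genA : B <*> <[x]> = A.
    apply/eqP; rewrite eqEsubset join_subG sBA cycle_subG Ax /=.
    case/maxgroupP: maxB => _ maxB; apply/negPn/negP=> notsAB.
    have prBx : B <*> <[x]> \proper A.
      by rewrite properE join_subG sBA cycle_subG Ax.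
    have eqB := maxB _ prBx (joing_subl _ _).
    by move: notBx; rewrite -eqB mem_gen // inE cycle_id orbT.
  by rewrite -genA centY cent_cycle setIACA setIid.
rewrite -(Lagrange_index sBA sCB) (p_maximal_index pA maxB).
rewrite -defA -(Lagrange_index (subsetIl G 'C(B)) (subsetIl 'C_G(B) 'C_G[x])).
rewrite mulnC leq_mul // indexgI.
apply: leq_trans cardxG; rewrite -index_cent1.
by rewrite subset_leq_card // imsetS // subsetIl.
Qed.

Theorem theorem3p3 (p : nat) (n : nat) (w : word n) (gT : finGroupType)
    (G : {group gT}) (p_pr : prime p) (pG : p.-group G)
    (wmaxG : w_maximal w G) (wintG : interchangeable p w G) :
  verbal w G \subset 'Z(G).
Proof.
set W := verbal_group w G.
have sWG : W \subset G := verbal_sub w G.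
have nWG : G \subset 'N(W) := verbal_norm w G.
rewrite subsetI sWG /= -[verbal w G]/(gval W).
apply/negPn/negP=> ncWG.
pose L := [~: W, G]%G.
have sLW : L \subset W by rewrite commg_subl.
have sLG := subset_trans sLW sWG.
have ntL : L :!=: 1 by apply: contra ncWG => /eqP/commG1P.
have prLG : [~: L, G] \proper L.
  apply: nil_comm_properl (pgroup_nil pG) sLG ntL _.
  by rewrite subsetI subxx commg_normr.
have [eqL | [N maxN sLGN]] := maximal_exists (proper_sub prLG).
  by rewrite eqL properxx in prLG.
have pL := pgroupS sLG pG.
have prN := maxgroupp maxN; have sNL := proper_sub prN.
have nsNL := p_maximal_normal pL maxN.
have iNL := p_maximal_index pL maxN.
have sNW := subset_trans sNL sLW; have sNG := subset_trans sNW sWG.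
have nNG : G \subset 'N(N).
  by rewrite -commg_subl (subset_trans _ sLGN) ?commSg.
have nNW := subset_trans sWG nNG.
pose C := (G :&: coset N @*^-1 'C(W / N))%G.
pose Z := (W :&: coset N @*^-1 'C(G / N))%G.
have sub_cent (A B : {group gT}) : A \subset 'N(N) -> B \subset 'N(N) ->
  (A \subset coset N @*^-1 'C(B / N)) = ([~: A, B] \subset N).
  by move=> nNA nNB; rewrite -sub_quotient_pre // -quotient_cents2.
have sCG : C \subset G := subsetIl _ _.
have sZW : Z \subset W := subsetIl _ _.
have sCWN : [~: C, W] \subset N.
  by rewrite -sub_cent ?subsetIr ?(subset_trans sCG).
have sNC : N \subset C by rewrite subsetI sNG sub_cosetpre.
have sNZ : N \subset Z by rewrite subsetI sNW sub_cosetpre.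
have nCG : C <| G.
  have nCN : G / N \subset 'N('C(W / N)) by rewrite norms_cent ?quotient_norms.
  rewrite /normal sCG normsI ?normG // -(quotientGK (_ : N <| G)) /normal ?sNG //.
  exact: morphpre_norms.
have sCwN : [~: verbal w C, G] \subset N.
  apply: subset_trans (wintG C nCG) _.
  by rewrite !mul_subG // -iNL power_subgroup_sub_index.
have swCZ : verbal w C \subset Z.
  have swCW : verbal w C \subset W := verbalS w sCG.
  by rewrite subsetI swCW sub_cent ?(subset_trans swCW).
have leCZ : (#|G : C| <= #|W : Z|)%N.
  rewrite -(@index_quotient_eq _ G N C) ?(setIidPr sNG) //.
  rewrite -(@index_quotient_eq _ W N Z) ?(setIidPr sNW) //.
  rewrite !quotient_setIpre; apply: (@index_cent_le _ p).
    exact: quotient_pgroup (pgroupS sWG pG).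
  by rewrite -quotientR // card_quotient ?normal_norm // iNL.
have prCG : C \proper G.
  rewrite properEneq sCG andbT; apply/eqP=> eqCG.
  move: prN; rewrite properE => /andP[_ /negP[]].
  by rewrite /= commGC -{1}eqCG.
have := wmaxG C prCG; rewrite ltnNge => /negP[].
(* Multiplied by |G : C|, the claim |G : W| <= |C : w(C)| compares the indices
   of Z and w(C) in G. *)
rewrite -(leq_pmul2l (indexg_gt0 G C)) (Lagrange_index sCG (verbal_sub w C)).
apply: leq_trans (dvdn_leq (indexg_gt0 _ _) (indexgS G swCZ)).
by rewrite -(Lagrange_index sWG sZW) mulnC leq_mul2l leCZ orbT.
Qed.
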